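(* There exist a constant $c_0\in(0,1)$ and a 1-sided error, nonadaptive, $t$-online-erasure-resilient $\varepsilon$-tester for linearity of functions $f:\{0,1\}^d\to\{0,1\}$ that is correct whenever $t\le c_0\cdot\varepsilon^{5/4}\cdot 2^{d/4}$ and makes $O\big(\frac1\varepsilon\log\frac t\varepsilon\big)$ queries.
   Context: Online-erasure model. An input is a function $f:D\to R$ on a finite domain $D$. An algorithm accesses $f$ only through an oracle $\mathcal{O}$ by querying points $x\in D$ one at a time and receiving $\mathcal{O}(x)$. Initially $\mathcal{O}(x)=f(x)$ for all $x\in D$. For $t\in\mathbb{N}$, a $t$-online-erasure oracle, after answering each query, may choose up to $t$ points $x\in D$ and set $\mathcal{O}(x)=\perp$ (a special ''erased'' symbol); these values are used to answer all future queries. The choice of erasures (the adversarial strategy) may depend on $f$, on the queries and answers so far, and on the algorithm's code, but not on the algorithm's future random coins; the algorithm does not know where erasures are. A property $\mathcal{P}$ is a set of functions; $f$ is $\varepsilon$-far from $\mathcal{P}$ if for every $g\in\mathcal{P}$, $f$ and $g$ differ on at least an $\varepsilon$ fraction of $D$. A $t$-online-erasure-resilient $\varepsilon$-tester for $\mathcal{P}$ is a randomized algorithm that, given $t,\varepsilon$ and access to $f$ via a $t$-online-erasure oracle, for every adversarial strategy accepts with probability at least $2/3$ if $f\in\mathcal{P}$ and rejects with probability at least $2/3$ if $f$ is $\varepsilon$-far from $\mathcal{P}$. It has 1-sided error if it accepts every $f\in\mathcal{P}$ with probability 1; it is nonadaptive if its queries do not depend on answers to previous queries. A function $f:\{0,1\}^d\to\{0,1\}$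 is linear if there is $S\subseteq[d]$ with $f(x)=\sum_{i\in S}x[i]\bmod 2$ for all $x$. *)

(* Defs.v *)
From mathcomp Require Import all_boot all_order all_algebra.
From mathcomp Require Import all_classical all_reals all_analysis.
Set Implicit Arguments. Unset Strict Implicit. Unset Printing Implicit Defensive.
Import Order.TTheory GRing.Theory Num.Theory.
Local Open Scope ring_scope.

Definition cube (d : nat) := {ffun 'I_d -> bool}.

Definition is_linear (d : nat) (f : cube d -> bool) : Prop :=
  exists S : {set 'I_d}, forall x : cube d, f x = odd (\sum_(i in S) (x i : nat))%N.

Definition eps_far_from_linear (R : realType) (d : nat) (eps : R)
  (f : cube d -> bool) : Prop :=
  forall g : cube d -> bool, is_linear g ->
    eps * #|[set: cube d]|%:R <= #|[set x : cube d | f x != g x]|%:R.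

(* A randomized NONADAPTIVE algorithm with oracle access to a function on D:
   random coins are drawn uniformly from the finite type [coins]; the
   sequence of queries depends only on the coins; the final decision
   (true = accept) depends on the coins and the sequence of answers
   (None = the erased symbol ⊥). *)
Record nonadaptive_alg (D : finType) := NonadaptiveAlg {
  coins : finType;
  queries : coins -> seq D;
  decide : coins -> seq (option bool) -> bool }.

(* An adversarial erasure strategy: after each query it erases the set
   [adv h], where h is the history of queries made so far (including the
   current one).  Since the answers are determined by f, the queries and the
   strategy's own past erasures, this captures dependence on queries and
   answers; dependence on f and on the algorithm is obtained by quantifying
   the strategy after them. *)
Definition strategy (D : finType) := seq D -> {set D}.

Definition t_bounded (D : finType) (t : nat) (adv : strategy D) : Prop :=
  forall h : seq D, (#|adv h| <= t)%N.

Fixpoint oracle_answers (D : finType) (f : D -> bool) (adv : strategy D)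
  (hist : seq D) (erased : {set D}) (qs : seq D) : seq (option bool) :=
  match qs with
  | [::] => [::]
  | q :: qs' =>
      let a := if q \in erased then None else Some (f q) in
      let hist' := rcons hist q in
      a :: oracle_answers f adv hist' (erased :|: adv hist') qs'
  end.

Definition accepts (D : finType) (A : nonadaptive_alg D) (f : D -> bool)
  (adv : strategy D) (w : coins A) : bool :=
  decide w (oracle_answers f adv [::] (@finset.set0 D) (queries w)).

Definition accept_prob (R : realType) (D : finType) (A : nonadaptive_alg D)
  (f : D -> bool) (adv : strategy D) : R :=
  #|[set w : coins A | accepts f adv w]|%:R / #|[set: coins A]|%:R.

Definition one_sided_linearity_tester (R : realType) (d t : nat) (eps : R)
  (A : nonadaptive_alg (cube d)) : Prop :=
  (forall f : cube d -> bool, is_linear f ->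
     forall adv : strategy (cube d), t_bounded t adv ->
       accept_prob R A f adv = 1) /\
  (forall f : cube d -> bool, eps_far_from_linear eps f ->
     forall adv : strategy (cube d), t_bounded t adv ->
       accept_prob R A f adv <= 1/3).

(* Main.v *)
Require Import Defs.
From mathcomp Require Import all_boot all_order all_algebra.
From mathcomp Require Import ring lra zify.
From mathcomp Require Import all_classical all_reals all_analysis.
Set Implicit Arguments. Unset Strict Implicit. Unset Printing Implicit Defensive.
Import Order.TTheory GRing.Theory Num.Theory.
Local Open Scope ring_scope.

(* The tester runs [r = O(1/eps)] independent batches.  A batch queries uniform
   points [x_1, ..., x_q], with [q = O(log (t/eps))], then the sum [y] of a
   uniformly random subfamily [m], and rejects when no answer was erased and
   [f y] differs from the sum of the [f x_i] over [m].

   For a fixed [m] of even size [k > 0], the expectation over [x] of the sign of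
   the test is the sum over [S] of [\hat F(S)^(k+1)], where [F = (-1)^f]; by
   Parseval this is at most [max(0, max_S \hat F(S)) <= 1 - eps] when [f] is
   [eps]-far from linear.  Hence a batch is violated with probability at least
   [eps/8].  Let [M] bound the total number of erasures.  Some [x_i] is erased
   with probability at most [q M / 2^d].  Unless the [x_i] are linearly dependent,
   which has probability at most [2^q / 2^d], distinct subfamilies have distinct
   sums, so [y] is erased with probability at most [M / 2^q].  For [2^q] of order
   [(t/eps)^3] the three errors are negligible against [eps], whatever happened
   in earlier batches, so each batch accepts with conditional probability at most
   [1 - eps/16]. *)

(** * Sums over tuples and subfamily sums *)

Lemma sum_tuple_cons (V : nmodType) (T : finType) n (F : seq T -> V) :
  \sum_(w : n.+1.-tuple T) F w = \sum_(a : T) \sum_(w : n.-tuple T) F (a :: w).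
Proof.
rewrite pair_big /=.
rewrite (reindex (fun p : T * n.-tuple T => [tuple of p.1 :: p.2])) /=.
  by apply: eq_bigr => -[a w].
exists (fun w : n.+1.-tuple T => (thead w, [tuple of behead w])) => [[a w]|w] _ /=.
  by congr pair; apply: val_inj.
by rewrite [RHS]tuple_eta; apply: val_inj.
Qed.

Lemma sum_tuple0 (V : nmodType) (T : finType) (F : seq T -> V) :
  \sum_(w : 0.-tuple T) F w = F [::].
Proof.
by rewrite (big_pred1 [tuple]) //= => w; apply/esym/eqP; rewrite [w]tuple0.
Qed.

Lemma sum_tuple_const (R : pzRingType) (T : finType) n (c : R) :
  \sum_(w : n.-tuple T) c = #|T|%:R ^+ n * c.
Proof. by rewrite sumr_const card_tuple -[LHS]mulr_natl natrX. Qed.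

Lemma card_set_sum (R : pzRingType) (T : finType) (P : pred T) :
  #|[set x | P x]|%:R = \sum_x (P x)%:R :> R.
Proof.
rewrite -sum1_card natr_sum big_mkcond /=; apply: eq_bigr => x _.
by rewrite inE; case: (P x).
Qed.

Lemma sum_indic_eq (R : pzRingType) (T : finType) (a : T) :
  \sum_(z : T) (z == a)%:R = 1 :> R.
Proof. by rewrite (bigD1 a) //= eqxx big1 ?addr0 // => z /negPf ->. Qed.

Section Mask.
Variable d : nat.
Notation D := {ffun 'I_d -> bool}.
Implicit Types (m : bitseq) (x : seq D).

Definition subset_sum m x := \sum_(z <- mask m x) z.

Lemma subset_sum_cons b m a x :
  subset_sum (b :: m) (a :: x) = a *+ b + subset_sum m x.
Proof. by rewrite /subset_sum; case: b => /=; rewrite ?big_cons ?add0r. Qed.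

(** Once the other entries are frozen, exactly one value of the first selected entry makes the sum
    equal to [b]. *)
Lemma count_subset_sum_eq (R : pzRingType) q m (b : D) : size m = q -> has id m ->
  #|D|%:R * \sum_(x : q.-tuple D) (subset_sum m x == b)%:R = #|D|%:R ^+ q :> R.
Proof.
elim: q m b => [|q IH] [|c m] b //= [sm].
rewrite (sum_tuple_cons q (fun s => (subset_sum (c :: m) s == b)%:R)) mulr_sumr.
case: c => /= hm.
  rewrite -mulr_sumr exchange_big /=.
  under eq_bigr => x _.
    under eq_bigr => a _ do
      rewrite subset_sum_cons mulr1n eq_sym -subr_eq eq_sym.
    rewrite sum_indic_eq; over.
  by rewrite sum_tuple_const mulr1 exprS.
under eq_bigr => a _.
  under eq_bigr => x _ do rewrite subset_sum_cons mulr0n add0r.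
  rewrite IH //; over.
by rewrite sumr_const -[LHS]mulr_natl exprS.
Qed.

Fixpoint xor_mask m1 m2 : bitseq :=
  match m1, m2 with
  | b1 :: m1', b2 :: m2' => (b1 (+) b2) :: xor_mask m1' m2'
  | _, _ => [::]
  end.

Lemma size_xor_mask m1 m2 : size m1 = size m2 -> size (xor_mask m1 m2) = size m1.
Proof. by elim: m1 m2 => [|b m1 IH] [|b2 m2] //= [/IH ->]. Qed.

Lemma has_xor_mask m1 m2 : size m1 = size m2 ->
  has id (xor_mask m1 m2) = (m1 != m2).
Proof.
elim: m1 m2 => [|b1 m1 IH] [|b2 m2] //= [/IH ->].
by rewrite eqseq_cons negb_and; case: b1 b2 => [] [].
Qed.

Lemma cube_char2 (x : D) : x + x = 0.
Proof. by apply/ffunP => i; rewrite !ffunE; case: (x i). Qed.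

(** An entry selected by both masks cancels in characteristic 2. Two distinct masks with equal sums
    therefore give a nonzero mask with sum 0. *)
Lemma subset_sum_xor m1 m2 x : size m1 = size x -> size m2 = size x ->
  subset_sum (xor_mask m1 m2) x = subset_sum m1 x + subset_sum m2 x.
Proof.
elim: x m1 m2 => [|a x IH] [|b1 m1] [|b2 m2] //=.
  by rewrite /subset_sum !big_nil addr0.
move=> [s1] [s2]; rewrite !subset_sum_cons IH // addrACA; congr (_ + _).
by case: b1 b2 => [] [] /=; rewrite ?mulr1n ?mulr0n ?addr0 ?add0r ?cube_char2.
Qed.

(** Linear dependence of the family [x] over the field with two elements. *)
Definition degenerate q (x : seq D) :=
  [exists m : q.-tuple bool, has id m && (subset_sum m x == 0)].

(** Union bound over the nonzero masks, each of which sums to 0 with probability [1 / #|D|]. *)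
Lemma count_degenerate (R : numDomainType) q :
  #|D|%:R * \sum_(x : q.-tuple D) (degenerate q x)%:R
    <= 2 ^+ q * #|D|%:R ^+ q :> R.
Proof.
apply: (@le_trans _ _ (\sum_(m : q.-tuple bool | has id m)
    (#|D|%:R * \sum_(x : q.-tuple D) (subset_sum m x == 0)%:R))).
  rewrite -mulr_sumr ler_wpM2l // exchange_big /= ler_sum // => x _.
  have [/existsP[m /andP[hm x0]]|_] := boolP (degenerate q x); last first.
    by rewrite sumr_ge0.
  by rewrite (bigD1 m) //= x0 lerDl sumr_ge0.
under eq_bigr => m hm do rewrite count_subset_sum_eq ?size_tuple //.
rewrite sumr_const -[leLHS]mulr_natl ler_wpM2r ?exprn_ge0 //.
by rewrite -natrX ler_nat (leq_trans (max_card _)) // card_tuple card_bool.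
Qed.

(* On a nondegenerate [x] the sum determines the mask, so at most [#|E|] masks
   hit [E]. *)
Lemma count_subset_sum_in (R : numDomainType) q (x : q.-tuple D) (E : {set D}) :
  \sum_(m : q.-tuple bool) (subset_sum m x \in E)%:R
    <= #|E|%:R + 2 ^+ q * (degenerate q x)%:R :> R.
Proof.
have [xd|xn] := boolP (degenerate q x).
  rewrite mulr1 ler_wpDl // -[leRHS]mulr1.
  have -> : 2 = #|{: bool}|%:R :> R by rewrite card_bool.
  by rewrite -sum_tuple_const ler_sum // => m _; rewrite lern1 leq_b1.
rewrite mulr0 addr0 -card_set_sum ler_nat.
rewrite -(card_in_imset (f := fun m : q.-tuple bool => subset_sum m x)).
  by apply/subset_leq_card/fintype.subsetP => _ /imsetP[m +->]; rewrite inE.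
move=> m1 m2 _ _ e; apply/eqP/negPn/negP => ne; case/existsP: xn.
have sz : size (xor_mask m1 m2) == q by rewrite size_xor_mask !size_tuple.
exists (Tuple sz) => /=.
by rewrite has_xor_mask ?size_tuple // ne subset_sum_xor ?size_tuple // e cube_char2 eqxx.
Qed.

End Mask.

(** * Fourier analysis of the violation probability *)

Section Fourier.
Variables (R : realType) (d : nat).
Notation D := {ffun 'I_d -> bool}.
Implicit Types (S : {set 'I_d}) (x y : D) (f : D -> bool).

Let N : R := #|D|%:R.

Definition chi S x : R := \prod_(i in S) (-1) ^+ (x i).

Lemma chiD S x y : chi S (x + y) = chi S x * chi S y.
Proof.
rewrite /chi -big_split /=; apply: eq_bigr => i _.
by rewrite ffunE signr_addb.
Qed.

Lemma chi0 S : chi S 0 = 1.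
Proof. by rewrite /chi big1 // => i _; rewrite ffunE expr0. Qed.

Lemma chi_linear S x : chi S x = (-1) ^+ odd (\sum_(i in S) (x i : nat))%N.
Proof. by rewrite signr_odd /chi -expr_sum. Qed.

Lemma cube_addr_eq0 x y : (x + y == 0) = (x == y).
Proof.
rewrite addr_eq0; congr (_ == _).
by apply/eqP; rewrite eq_sym -addr_eq0 cube_char2.
Qed.

(** The sum factors over coordinates as the product of the [1 + (-1) ^+ x i], which vanishes as soon
    as some [x i] is true. *)
Lemma sum_chi x : \sum_S chi S x = N * (x == 0)%:R.
Proof.
transitivity (\prod_(i < d) ((-1) ^+ (x i) + 1 : R)).
  rewrite bigA_distr /=; apply: eq_bigr => S _.
  by rewrite /chi big_mkcond.
have [->|] := eqVneq.
  rewrite mulr1 /N card_ffun card_bool card_ord natrX.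
  rewrite (eq_bigr (fun _ => 2)); first by rewrite prodr_const card_ord.
  by move=> i _; rewrite ffunE expr0.
rewrite mulr0 => /eqP xn0; apply/eqP/prodf_eq0.
suff [i xi] : exists i, x i by exists i => //; rewrite xi expr1 addNr.
apply: contrapT => h; apply: xn0; apply/ffunP => i; rewrite ffunE.
by apply: (@negbTE (x i)); apply/negP => xi; apply: h; exists i.
Qed.

Definition sgn f x : R := (-1) ^+ f x.

Definition fourier f S : R := N^-1 * \sum_x sgn f x * chi S x.

Lemma card_cube_gt0 : 0 < N.
Proof. by rewrite ltr0n; apply/card_gt0P; exists 0. Qed.

Lemma fourier_inversion f y : sgn f y = \sum_S fourier f S * chi S y.
Proof.
have N0 : N != 0 by rewrite gt_eqF ?card_cube_gt0.
under eq_bigr => S _.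
  rewrite /fourier -mulrA mulr_suml.
  under eq_bigr => x _ do rewrite -mulrA -chiD.
  over.
rewrite -mulr_sumr exchange_big /=.
under eq_bigr => x _ do rewrite -mulr_sumr sum_chi cube_addr_eq0.
rewrite (bigD1 y) //= eqxx big1 => [|x /negPf ->]; last by rewrite !mulr0.
by rewrite addr0 mulr1 mulrCA mulVf // mulr1.
Qed.

Lemma sgnK f x : sgn f x * sgn f x = 1.
Proof. by rewrite -signr_addb addbb. Qed.

Lemma parseval f : \sum_S fourier f S ^+ 2 = 1.
Proof.
have N0 : N != 0 by rewrite gt_eqF ?card_cube_gt0.
under eq_bigr => S _.
  rewrite expr2 {2}/fourier mulrCA mulr_sumr.
  under eq_bigr => x _ do rewrite mulrCA.
  over.
rewrite -mulr_sumr exchange_big /=.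
under eq_bigr => x _ do rewrite -mulr_sumr -fourier_inversion sgnK.
by rewrite sumr_const mulVf.
Qed.

(** By independence each selected entry contributes [N * fourier f S], and each unselected one
    [N]. *)
Lemma sum_sgn_mask f S q (m : bitseq) : size m = q ->
  \sum_(x : q.-tuple D) \prod_(z <- mask m x) (sgn f z * chi S z)
    = N ^+ q * fourier f S ^+ count id m.
Proof.
have N0 : N != 0 by rewrite gt_eqF ?card_cube_gt0.
elim: q m => [|q IH] [|b m] //= => [_|[sm]].
  under eq_bigr => x _ do rewrite big_nil.
  by rewrite sum_tuple_const !mulr1.
rewrite (sum_tuple_cons q (fun s => \prod_(z <- mask (b :: m) s) (sgn f z * chi S z))).
case: b => /=.
  under eq_bigr => a _.
    under eq_bigr => x _ do rewrite big_cons.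
    rewrite -mulr_sumr IH //; over.
  rewrite -mulr_suml add1n !exprS /fourier.
  by field.
under eq_bigr => a _ do rewrite IH //.
by rewrite sumr_const -[LHS]mulr_natl add0n exprS mulrA.
Qed.

Lemma chi_subset_sum S m (x : seq D) :
  chi S (subset_sum m x) = \prod_(z <- mask m x) chi S z.
Proof.
rewrite /subset_sum; elim: (mask m x) => [|a s IH]; first by rewrite !big_nil chi0.
by rewrite !big_cons chiD IH.
Qed.

(** Fourier inversion at the sum, where [chi S] splits over the selected entries; the inversion
    coefficient supplies the extra power. *)
Lemma sum_sgn_subset_sum f q m : size m = q ->
  \sum_(x : q.-tuple D) (\prod_(z <- mask m x) sgn f z) * sgn f (subset_sum m x)
    = N ^+ q * \sum_S fourier f S ^+ (count id m).+1.
Proof.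
move=> sm.
transitivity (\sum_(x : q.-tuple D) \sum_S
    fourier f S * \prod_(z <- mask m x) (sgn f z * chi S z)).
  apply: eq_bigr => x _; rewrite (fourier_inversion f (subset_sum m x)) mulr_sumr.
  by apply: eq_bigr => S _; rewrite mulrCA chi_subset_sum -big_split.
rewrite exchange_big mulr_sumr /=; apply: eq_bigr => S _.
by rewrite -mulr_sumr sum_sgn_mask // exprS mulrCA.
Qed.

(** Split off a square from each power and sum the squares by Parseval. The remaining odd power is
    at most [c], since negative coefficients only help; an even power would not tolerate a
    coefficient near -1, as the complement of a linear function has. *)
Lemma sum_fourier_pow_le f k (c : R) : 0 <= c -> (forall S, fourier f S <= c) ->
  (0 < k)%N -> ~~ odd k -> \sum_S fourier f S ^+ k.+1 <= c.
Proof.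
move=> c0 fc k0 ek.
have [j ->] : exists j, k = (j.*2.+2)%N.
  by exists (k./2.-1)%N; have := odd_double_half k; rewrite (negPf ek); lia.
rewrite -[leRHS]mulr1 -(parseval f) mulr_sumr ler_sum // => S _.
rewrite -addn3 addnC !exprD; set a := fourier f S.
have a21 : a ^+ 2 <= 1.
  by rewrite -(parseval f) (bigD1 S) //= lerDl sumr_ge0 // => ? _; exact: sqr_ge0.
rewrite -[(_.*2)%N]mul2n exprM.
have aj : 0 <= (a ^+ 2) ^+ j <= 1 by rewrite exprn_ge0 ?sqr_ge0 //= exprn_ile1 // sqr_ge0.
have -> : a ^+ 3 = a * a ^+ 2 by rewrite exprS.
rewrite mulrAC ler_wpM2r ?sqr_ge0 //.
have [a0|a0] := ltP 0 a; last first.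
  by rewrite (le_trans _ c0) // mulr_le0_ge0 //; case/andP: aj.
by apply: le_trans (fc S); rewrite ler_piMr ?(ltW a0) //; case/andP: aj.
Qed.

Definition violates f m (x : seq D) :=
  odd (count f (mask m x)) (+) f (subset_sum m x).

Lemma violates_sgn f m (x : seq D) :
  (violates f m x)%:R =
  (1 - (\prod_(z <- mask m x) sgn f z) * sgn f (subset_sum m x)) / 2.
Proof.
have -> : \prod_(z <- mask m x) sgn f z = (-1) ^+ odd (count f (mask m x)).
  elim: (mask m x) => [|a s IH]; first by rewrite big_nil.
  by rewrite big_cons IH /= oddD signr_addb oddb.
rewrite /violates /sgn -signr_addb.
by case: (_ (+) _) => /=; rewrite ?expr0 ?expr1; lra.
Qed.

(** The coefficient at [S] is 1 minus twice the fraction of points where [f] differs from the linear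
    function of [S]. *)
Lemma fourier_far f (eps : R) S : eps_far_from_linear eps f ->
  fourier f S <= 1 - 2 * eps.
Proof.
move=> far; have N0 := card_cube_gt0.
have := far (fun x => odd (\sum_(i in S) (x i : nat))%N) (ex_intro _ S (fun=> erefl)).
rewrite cardsT -/N card_set_sum => le_dist.
rewrite /fourier ler_pdivrMl //.
have -> : \sum_x sgn f x * chi S x =
    N - 2 * \sum_x (f x != odd (\sum_(i in S) (x i : nat))%N)%:R.
  rewrite mulr_sumr /N -[#|_|]cardsT -sum1_card natr_sum.
  under [in RHS]eq_bigl do rewrite inE.
  rewrite -sumrB; apply: eq_bigr => x _.
  rewrite chi_linear /sgn -signr_addb -addbN.
  by case: (f x) (odd _) => [] [] /=; rewrite ?expr0 ?expr1; lra.
by lra.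
Qed.

Lemma count_violates_even f (eps : R) q m : 0 < eps < 1 ->
  eps_far_from_linear eps f -> size m = q -> has id m -> ~~ odd (count id m) ->
  N ^+ q * (eps / 2) <= \sum_(x : q.-tuple D) (violates f m x)%:R.
Proof.
move=> /andP[e0 e1] far sm hm em.
under eq_bigr => x _ do rewrite violates_sgn.
rewrite -mulr_suml sumrB sum_tuple_const mulr1 sum_sgn_subset_sum //.
have : \sum_S fourier f S ^+ (count id m).+1 <= 1 - eps.
  (* The bound [1 - 2 * eps] may be negative, so it is relaxed to [1 - eps]. *)
  apply: sum_fourier_pow_le => //; first by rewrite subr_ge0 ltW.
    by move=> S; rewrite (le_trans (fourier_far S far)) //; lra.
  by rewrite -has_count.
rewrite -/N -(ler_pM2l (exprn_gt0 q card_cube_gt0)); lra.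
Qed.

(** Flipping the first bit exchanges the parities; the induction carries both at once. *)
Lemma count_even_masks q :
  \sum_(m : q.+1.-tuple bool) (~~ odd (count id m))%:R = 2 ^+ q :> R.
Proof.
suff h n b : \sum_(m : n.+1.-tuple bool) (odd (count id m) == b)%:R = 2 ^+ n :> R.
  rewrite -(h q false); apply: eq_bigr => m _; by case: (odd _).
elim: n b => [|n IH] b;
  rewrite (sum_tuple_cons _ (fun s => (odd (count id s) == b)%:R)) big_bool /=.
  rewrite (sum_tuple0 (fun s => (odd (1 + count id s) == b)%:R)).
  rewrite (sum_tuple0 (fun s => (odd (0 + count id s) == b)%:R)) /=.
  by case: b; rewrite ?addr0 ?add0r.
rewrite exprS mulr2n mulrDl !mul1r -{1}(IH (~~ b)) -(IH b).
by congr (_ + _); apply: eq_bigr => m _; rewrite oddD ?oddb /=; case: (odd _) b => [] [].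
Qed.

(** Half of the masks are even. As [q >= 2], at least a quarter of all masks remain after discarding
    the zero mask, and each is violated with probability at least [eps / 2]. *)
Lemma count_violates f (eps : R) q : 0 < eps < 1 -> eps_far_from_linear eps f ->
  (1 < q)%N ->
  N ^+ q * 2 ^+ q * (eps / 8) <=
    \sum_(x : q.-tuple D) \sum_(m : q.-tuple bool) (violates f m x)%:R.
Proof.
move=> eps01 far; case: q => [|[|q]] // _; rewrite exchange_big /=.
set Nq := N ^+ q.+2.
have c0 : 0 <= Nq * (eps / 2).
  by rewrite mulr_ge0 ?exprn_ge0 ?ler0n // divr_ge0 // ltW //; case/andP: eps01.
apply: (@le_trans _ _ (\sum_(m : q.+2.-tuple bool)
   Nq * (eps / 2) * ((~~ odd (count id m))%:R - (count id m == 0)%:R))).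
  rewrite -mulr_sumr sumrB count_even_masks.
  have le1 : \sum_(m : q.+2.-tuple bool) (count id m == 0)%:R <= 1 :> R.
    rewrite -card_set_sum -[1]/(1%:R) ler_nat.
    rewrite -(cards1 [tuple of nseq q.+2 false]).
    apply/subset_leq_card/fintype.subsetP => m.
    rewrite !inE -leqn0 leqNgt -has_count => nm; apply/eqP/val_inj.
    suff : tval m = nseq (size m) false by rewrite size_tuple.
    apply/all_pred1P/allP => b mb; apply: contraR nm => nb.
    by apply/hasP; exists b => //; case: b nb {mb}.
  have : 1 <= 2 ^+ q :> R by rewrite exprn_ege1 // ler1n.
  rewrite !exprS; set P := 2 ^+ q; move: (\sum_m _) le1 => s s1 P1.
  have -> : Nq * (2 * (2 * P)) * (eps / 8) = Nq * (eps / 2) * P by field.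
  by rewrite ler_wpM2l //; lra.
apply: ler_sum => m _.
have [em|om] := boolP (~~ odd (count id m)); last first.
  apply: (@le_trans _ _ 0); last by rewrite sumr_ge0.
  by rewrite sub0r mulrN oppr_le0 mulr_ge0.
case: eqVneq => [_|cm]; first by rewrite subrr mulr0 sumr_ge0.
rewrite subr0 mulr1; apply: count_violates_even => //; first exact: size_tuple.
by rewrite has_count lt0n.
Qed.

End Fourier.

(** * Online erasures and the tester *)

Section Oracle.
Variables (D : finType) (f : D -> bool) (adv : strategy D) (t : nat).
Implicit Types (hist s : seq D) (E : {set D}).

(** Exposes the final state of [oracle_answers], so that a run can be cut at batch boundaries. *)
Fixpoint erased_after hist E s : {set D} :=
  if s is a :: s' then
    erased_after (rcons hist a) (E :|: adv (rcons hist a)) s'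
  else E.

Lemma size_oracle_answers hist E s : size (oracle_answers f adv hist E s) = size s.
Proof. by elim: s hist E => //= a s IH hist E; rewrite IH. Qed.

Lemma oracle_answers_cat hist E s1 s2 :
  oracle_answers f adv hist E (s1 ++ s2) = oracle_answers f adv hist E s1 ++
    oracle_answers f adv (hist ++ s1) (erased_after hist E s1) s2.
Proof.
by elim: s1 hist E => [|a s1 IH] hist E /=; rewrite ?cats0 // IH cat_rcons.
Qed.

Lemma oracle_answers_noerasure hist E s :
  None \notin oracle_answers f adv hist E s ->
  oracle_answers f adv hist E s = [seq Some (f z) | z <- s].
Proof.
elim: s hist E => //= a s IH hist E.
by rewrite inE negb_or; case: (a \in E) => //= /IH ->.
Qed.

Hypothesis bounded : t_bounded t adv.

Lemma card_erased_after hist E s : (#|erased_after hist E s| <= #|E| + t * size s)%N.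
Proof.
elim: s hist E => [|a s IH] hist E /=; first by rewrite muln0 addn0.
apply: leq_trans (IH _ _) _; rewrite mulnS addnA leq_add2r.
by rewrite (leq_trans (leq_card_setU _ _)) // leq_add2l.
Qed.

(** The erased set depends on earlier queries only, so each fresh uniform query hits it with
    probability at most [M / #|D|]. The induction sums this over [q] queries. *)
Lemma count_erased_query (R : numDomainType) q (M : nat) hist E :
  (#|E| + t * q <= M)%N ->
  #|D|%:R * \sum_(s : q.-tuple D) (None \in oracle_answers f adv hist E s)%:R
    <= (q * M)%:R * #|D|%:R ^+ q :> R.
Proof.
elim: q hist E => [|q IH] hist E le_M.
  rewrite (sum_tuple0 (fun s => (None \in oracle_answers f adv hist E s)%:R)).
  by rewrite mulr0 mul0r.
rewrite (sum_tuple_cons q (fun s => (None \in oracle_answers f adv hist E s)%:R)).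
rewrite mulr_sumr.
apply: (@le_trans _ _ (\sum_(a : D) ((a \in E)%:R * #|D|%:R ^+ q.+1 +
    (q * M)%:R * #|D|%:R ^+ q))).
  apply: ler_sum => a _ /=.
  apply: (@le_trans _ _ (#|D|%:R * \sum_(s : q.-tuple D)
     ((a \in E)%:R +
      (None \in oracle_answers f adv (rcons hist a) (E :|: adv (rcons hist a)) s)%:R))).
    rewrite ler_wpM2l // ler_sum // => s _.
    rewrite inE; case: (a \in E) => //=; last by rewrite add0r.
    by rewrite lerDl.
  rewrite big_split /= mulrDr lerD //.
    by rewrite sum_tuple_const mulrA -exprS mulrC.
  apply: IH; apply: leq_trans le_M; rewrite mulnS addnA leq_add2r.
  by rewrite (leq_trans (leq_card_setU _ _)) // leq_add2l.
rewrite big_split /= -mulr_suml sumr_const -[X in _ + X <= _]mulr_natl.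
rewrite [X in _ + X]mulrCA -exprS -mulrDl ler_wpM2r ?exprn_ge0 //.
rewrite mulSn natrD lerD // -card_set_sum ler_nat.
by rewrite (eq_card (B := E)) => [|x]; rewrite ?inE // (leq_trans _ le_M) // leq_addr.
Qed.

End Oracle.

(** * Completeness and soundness of the batched tester *)

Section Tester.
Variables (d q : nat).
Notation D := (cube d).

Definition batch := (q.-tuple D * q.-tuple bool)%type.

Definition batch_queries (b : batch) : seq D := rcons b.1 (subset_sum b.2 b.1).

(* The last answer, at the sum itself, is always selected: hence [rcons _ true]. *)
Definition batch_rejects (b : batch) (ans : seq (option bool)) : bool :=
  (None \notin ans) && odd (count id (mask (rcons b.2 true) (pmap id ans))).

Fixpoint accept_batches (bs : seq batch) (ans : seq (option bool)) : bool :=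
  if bs is b :: bs' then
    ~~ batch_rejects b (take q.+1 ans) && accept_batches bs' (drop q.+1 ans)
  else true.

Definition tester (r : nat) : nonadaptive_alg D :=
  @NonadaptiveAlg D (r.-tuple batch : finType)
    (fun w => flatten (map batch_queries w)) (fun w => accept_batches w).

Lemma size_batch_queries b : size (batch_queries b) = q.+1.
Proof. by rewrite size_rcons size_tuple. Qed.

Lemma size_tester_queries r (w : coins (tester r)) :
  size (queries w) = (r * q.+1)%N.
Proof.
rewrite -{2}(size_tuple (w : r.-tuple batch)) /=; elim: (tval _) => //= b bs IH.
by rewrite size_cat IH size_batch_queries mulSn.
Qed.

Variable f : D -> bool.

Lemma batch_rejectsE (b : batch) adv hist E :
  batch_rejects b (oracle_answers f adv hist E (batch_queries b)) =
  (None \notin oracle_answers f adv hist E (batch_queries b)) && violates f b.2 b.1.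
Proof.
rewrite /batch_rejects; have [//|/oracle_answers_noerasure ->] := boolP (_ \in _).
rewrite /= (map_comp Some f) (@map_pK _ _ id Some) // -map_mask count_map.
by rewrite mask_rcons ?size_tuple // count_cat oddD /= addn0 oddb.
Qed.

Lemma accept_batches_cons adv hist E b (bs : seq batch) :
  accept_batches (b :: bs)
    (oracle_answers f adv hist E (flatten (map batch_queries (b :: bs)))) =
  ~~ batch_rejects b (oracle_answers f adv hist E (batch_queries b)) &&
  accept_batches bs (oracle_answers f adv (hist ++ batch_queries b)
    (erased_after adv hist E (batch_queries b)) (flatten (map batch_queries bs))).
Proof.
rewrite [flatten _]/= oracle_answers_cat [LHS]/=.
by rewrite take_size_cat ?drop_size_cat // size_oracle_answers size_batch_queries.
Qed.

Lemma linear_violates m (x : seq D) : is_linear f -> violates f m x = false.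
Proof.
move=> [S fE]; rewrite /violates /subset_sum.
have {}fE a : f a = \big[addb/false]_(i in S) a i.
  by rewrite fE (big_morph odd oddD erefl); apply: eq_bigr => i _; rewrite oddb.
have fD a b : f (a + b) = f a (+) f b.
  by rewrite !fE -big_split /=; apply: eq_bigr => i _; rewrite ffunE.
elim: (mask m x) => [|a s IH] /=.
  by rewrite big_nil /= fE big1 // => i _; rewrite ffunE.
by rewrite big_cons fD oddD oddb addbACA addbb IH.
Qed.

(** Erasures can only suppress a rejection, and linear functions violate no batch. *)
Lemma linear_accepts adv hist E (bs : seq batch) : is_linear f ->
  accept_batches bs (oracle_answers f adv hist E (flatten (map batch_queries bs))).
Proof.
move=> lin; elim: bs hist E => // b bs IH hist E.
by rewrite accept_batches_cons batch_rejectsE linear_violates // andbF IH.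
Qed.

(** The case [M = 0] is separate because without erasures dependent tuples are harmless; the
    condition then holds in every dimension. *)
Variables (R : realType) (t M : nat) (adv : strategy D) (eps : R).
Hypotheses (bounded : t_bounded t adv) (q_gt1 : (1 < q)%N)
  (eps01 : 0 < eps < 1) (far : eps_far_from_linear eps f)
  (M_eps : (q * M)%:R / #|D|%:R +
    (if M == 0%N then 0 else M%:R / 2 ^+ q + 2 ^+ q / #|D|%:R) <= eps / 16).

(** When the sum is queried, the erased set depends on [x] but not on the mask, which is still
    uniform given [x]. *)
Lemma count_erased_sum hist (E : {set D}) : (#|E| + t * q <= M)%N ->
  \sum_(x : q.-tuple D) \sum_(m : q.-tuple bool)
    (subset_sum m x \in erased_after adv hist E x)%:R <=
  #|D|%:R ^+ q * 2 ^+ q *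
    (if M == 0%N then 0 else M%:R / 2 ^+ q + 2 ^+ q / #|D|%:R) :> R.
Proof.
move=> le_M.
have le_card (x : q.-tuple D) : (#|erased_after adv hist E x| <= M)%N.
  by rewrite (leq_trans (card_erased_after bounded _ _ _)) // size_tuple.
have N0 : 0 < #|D|%:R :> R by exact: card_cube_gt0.
case: eqP => [M0|_].
  rewrite mulr0 big1 // => x _; rewrite big1 // => m _.
  have := le_card x; rewrite M0 leqn0 cards_eq0 => /eqP ->.
  by rewrite inE.
apply: (@le_trans _ _ (\sum_(x : q.-tuple D) (M%:R + 2 ^+ q * (degenerate q x)%:R))).
  apply: ler_sum => x _; apply: le_trans (count_subset_sum_in _ _ _) _.
  by rewrite lerD2r ler_nat.
rewrite big_split /= sum_tuple_const -mulr_sumr mulrDr lerD //.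
  by rewrite -mulrA [_ * (M%:R / _)]mulrCA mulfV ?mulr1 // expf_neq0 ?pnatr_eq0.
rewrite [leRHS](_ : _ = 2 ^+ q * (#|D|%:R^-1 * (2 ^+ q * #|D|%:R ^+ q))); last by ring.
by rewrite ler_wpM2l ?exprn_ge0 // ler_pdivlMl //; exact: count_degenerate.
Qed.

(** A surviving batch is unviolated or meets an erasure: violations gain [eps / 8], erasures lose at
    most [eps / 16]. The initial state is arbitrary, so the bound holds conditionally on the
    past. *)
Lemma batch_survival hist (E : {set D}) : (#|E| + t * q <= M)%N ->
  \sum_(b : batch) (~~ batch_rejects b
      (oracle_answers f adv hist E (batch_queries b)))%:R
    <= (1 - eps / 16) * #|{: batch}|%:R :> R.
Proof.
move=> le_M.
have N0 : 0 < #|D|%:R :> R by exact: card_cube_gt0.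
have cardB : #|{: batch}|%:R = #|D|%:R ^+ q * 2 ^+ q :> R.
  by rewrite card_prod !card_tuple card_bool natrM !natrX.
pose bad (x : q.-tuple D) := None \in oracle_answers f adv hist E x.
pose hit (x : q.-tuple D) (m : q.-tuple bool) :=
  subset_sum m x \in erased_after adv hist E x.
apply: (@le_trans _ _ (\sum_(b : batch)
   (1 - (violates f b.2 b.1)%:R + (bad b.1)%:R + (hit b.1 b.2)%:R))).
  apply: ler_sum => -[x m] _ /=; rewrite batch_rejectsE /=.
  rewrite /batch_queries -cats1 oracle_answers_cat mem_cat /= inE -/(bad x) -/(hit x m).
  by case: (bad x); case: (hit x m); case: (violates _ _ _) => /=; lra.
rewrite -(pair_bigA _ (fun (x : q.-tuple D) (m : q.-tuple bool) =>
  1 - (violates f m x)%:R + (bad x)%:R + (hit x m)%:R)) /=.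
have viol := count_violates eps01 far q_gt1.
have hits := count_erased_sum hist le_M.
have bads : \sum_(x : q.-tuple D) \sum_(m : q.-tuple bool) (bad x)%:R <=
    #|D|%:R ^+ q * 2 ^+ q * ((q * M)%:R / #|D|%:R) :> R.
  under eq_bigr => x _ do rewrite sum_tuple_const card_bool.
  rewrite -mulr_sumr.
  rewrite [leRHS](_ : _ = 2 ^+ q * (#|D|%:R^-1 * ((q * M)%:R * #|D|%:R ^+ q)));
    last by ring.
  by rewrite ler_wpM2l ?exprn_ge0 // ler_pdivlMl //; exact: count_erased_query.
under eq_bigr => x _ do rewrite !big_split /= sumrN.
rewrite !big_split /= sumrN.
under eq_bigr => x _ do rewrite sum_tuple_const mulr1 card_bool.
rewrite sum_tuple_const cardB.
have comb (K V H B h b : R) : 0 <= K -> K * (eps / 8) <= V -> H <= K * h ->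
    B <= K * b -> b + h <= eps / 16 -> K - V + B + H <= (1 - eps / 16) * K.
  by move=> K0 leV leH leB /(ler_wpM2l K0); lra.
by apply: comb viol hits bads M_eps; rewrite mulr_ge0 // exprn_ge0 // ltW.
Qed.

(** Induction on batches: for each first batch, the bound applies to the rest from the resulting
    state, whose erasure budget still fits in [M]. *)
Lemma tester_survival r hist (E : {set D}) : (#|E| + t * (r * q.+1) <= M)%N ->
  \sum_(w : r.-tuple batch)
    (accept_batches w
      (oracle_answers f adv hist E (flatten (map batch_queries w))))%:R
    <= ((1 - eps / 16) * #|{: batch}|%:R) ^+ r :> R.
Proof.
elim: r hist E => [|r IH] hist E le_M.
  by rewrite (sum_tuple0 (fun w => (accept_batches w (oracle_answers f adv hist E
     (flatten (map batch_queries w))))%:R)).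
rewrite (sum_tuple_cons r (fun w => (accept_batches w (oracle_answers f adv hist E
     (flatten (map batch_queries w))))%:R)).
have c0 : 0 <= (1 - eps / 16) * #|{: batch}|%:R.
  by rewrite mulr_ge0 // subr_ge0; case/andP: eps01; lra.
apply: (@le_trans _ _ (\sum_(b : batch) (~~ batch_rejects b
      (oracle_answers f adv hist E (batch_queries b)))%:R *
      ((1 - eps / 16) * #|{: batch}|%:R) ^+ r)).
  apply: ler_sum => b _.
  under eq_bigr => w _ do rewrite accept_batches_cons -mulnb natrM.
  rewrite -mulr_sumr ler_wpM2l // IH //.
  apply: leq_trans le_M.
  apply: leq_trans (leq_add (card_erased_after bounded _ _ _) (leqnn _)) _.
  by rewrite size_batch_queries -addnA -mulnDr -mulSn.
rewrite -mulr_suml exprS ler_wpM2r ?exprn_ge0 // batch_survival //.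
by apply: leq_trans le_M; rewrite leq_add2l leq_mul2l; apply/orP; right; lia.
Qed.

End Tester.

(** * Choice of the parameters *)

(** The induction step is [(1 - a) * (1 + (r + 1) * a) <= 1 + r * a]. *)
Lemma expr_1B_bernoulli (R : realDomainType) (a : R) r : 0 <= a <= 1 ->
  (1 - a) ^+ r * (1 + r%:R * a) <= 1.
Proof.
move=> /andP[a0 a1]; elim: r => [|r IH]; first by rewrite expr0 mul0r addr0 mulr1.
apply: le_trans IH; rewrite exprSr -mulrA ler_wpM2l ?exprn_ge0 ?subr_ge0 //.
have : 0 <= r.+1%:R * a * a by rewrite !mulr_ge0.
rewrite -natr1; nra.
Qed.

Lemma tester_correct (R : realType) d q r t (eps : R) : (1 < q)%N -> 0 < eps < 1 ->
  32 <= r%:R * eps ->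
  (q * (t * (r * q.+1)))%:R / #|cube d|%:R +
    (if (t * (r * q.+1))%N == 0%N then 0
     else (t * (r * q.+1))%:R / 2 ^+ q + 2 ^+ q / #|cube d|%:R) <= eps / 16 ->
  one_sided_linearity_tester t eps (tester d q r).
Proof.
move=> q1 eps01 r_eps M_eps.
have coins0 : #|[set: coins (tester d q r)]|%:R != 0 :> R.
  rewrite pnatr_eq0 -lt0n; apply/card_gt0P.
  by exists [tuple of nseq r ([tuple of nseq q 0], [tuple of nseq q false])].
split=> f; rewrite /accept_prob /accepts.
  move=> lin adv _; rewrite (_ : [set w | _] = [set: _]) ?divff //.
  by apply/setP => w; rewrite !inE /= linear_accepts.
move=> far adv bounded.
have := @tester_survival d q f R t _ adv eps bounded q1 eps01 far M_eps r
  [::] (@finset.set0 _).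
rewrite cards0 add0n leqnn => /(_ isT).
rewrite card_set_sum exprMn => acc.
rewrite ler_pdivrMr ?lt_def ?coins0 //= cardsT card_tuple natrX.
apply: (le_trans acc); rewrite ler_wpM2r ?exprn_ge0 //.
have /andP[e0 e1] := eps01.
(* Since [r * (eps / 16) >= 2], the survival probability is at most [1 / (1 + 2)]. *)
have := @expr_1B_bernoulli R (eps / 16) r ltac:(lra).
have : 0 <= (1 - eps / 16) ^+ r by rewrite exprn_ge0 //; lra.
set X := (_ ^+ r); nra.
Qed.

Lemma nat_ceil (R : realType) (x : R) : 0 <= x -> exists r : nat, x <= r%:R <= x + 1.
Proof.
move=> x0; have /andP[le lt] := truncn_itv x0.
by exists (Num.truncn x).+1; rewrite (ltW lt) -natr1 lerD2r.
Qed.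

Lemma pow2_approx (R : realType) (x : R) : 1 <= x ->
  exists l : nat, 2 ^+ l <= x <= 2 * 2 ^+ l.
Proof.
move=> x1; have /andP[le lt] := truncn_itv (le_trans ler01 x1).
have k0 : (0 < Num.truncn x)%N by rewrite truncn_gt0.
have /andP[le2 lt2] := trunc_log_bounds (isT : (1 < 2)%N) k0.
exists (trunc_log 2 (Num.truncn x)); rewrite -exprS -!natrX; apply/andP; split.
  by apply: le_trans le; rewrite ler_nat.
by apply/ltW/(lt_le_trans lt); rewrite ler_nat.
Qed.

(** Fourth powers clear the fractional exponents and leave a polynomial inequality. *)
Lemma bound_pow4 (R : realType) d (t : nat) (c eps : R) : 0 <= c -> 0 <= eps ->
  t%:R <= c * powR eps (5 / 4) * powR 2 (d%:R / 4) ->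
  t%:R ^+ 4 <= c ^+ 4 * eps ^+ 5 * #|cube d|%:R.
Proof.
move=> c0 e0 /(lerXn2r 4); rewrite !nnegrE !mulr_ge0 ?powR_ge0 // => /(_ (ler0n _ _) isT).
rewrite !exprMn -!powR_mulrn ?powR_ge0 // -!powRrM.
have -> : 5 / 4 * 4%:R = 5%:R :> R by field.
have -> : d%:R / 4 * 4%:R = d%:R :> R by field.
by rewrite !powR_mulrn // card_ffun card_bool card_ord natrX.
Qed.

Lemma ln2_ge_half (R : realType) : 1 / 2 <= ln 2 :> R.
Proof.
have := @le_ln1Dx R (- (1 / 2)) ltac:(lra).
have -> : 1 - 1 / 2 = 2^-1 :> R by field.
by rewrite lnV ?posrE //; lra.
Qed.

Lemma log2_le_ln (R : realType) (x : R) l : 2 ^+ l <= x -> l%:R <= 2 * ln (1 + x).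
Proof.
move=> lx; have p0 : 0 < 2 ^+ l :> R by rewrite exprn_gt0.
have : ln (2 ^+ l) <= ln (1 + x) by rewrite ler_ln ?posrE; lra.
rewrite lnXn // -[ln 2 *+ l]mulr_natl.
have : 0 <= l%:R * (ln 2 - 1 / 2) :> R by rewrite mulr_ge0 // subr_ge0 ln2_ge_half.
lra.
Qed.

(* Applied with [N = 2^d], [T = t / eps], [P] the power of two [2^l <= T < 2^(l+1)],
   [Q = 2^q] for [q = 3 l + 23], and [M] the total number of erasures. *)
Lemma erasure_budget (R : realType) (N eps T P Q q M : R) :
  0 < N -> 0 < eps -> 1 <= eps * T -> 1 <= T -> 1 <= P -> P <= T -> T <= 2 * P ->
  0 <= q -> 0 <= M -> q <= 23 * P -> M <= 792 * T * P -> Q = 2 ^+ 23 * P ^+ 3 ->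
  2 ^+ 36 * T ^+ 4 <= eps * N ->
  q * M / N + (M / Q + Q / N) <= eps / 16.
Proof.
move=> N0 e0 eT T1 P1 PT TP q0 M0 qP MP Qdef TN.
have P20 : 0 <= P ^+ 2 by exact: sqr_ge0.
have PT2 : P ^+ 2 <= T ^+ 2 by rewrite lerXn2r ?nnegrE //; lra.
have PT3 : P ^+ 3 <= T ^+ 3 by rewrite lerXn2r ?nnegrE //; lra.
have T34 : T ^+ 3 <= T ^+ 4 by rewrite ler_weXn2l.
have T30 : 0 <= T ^+ 3 by rewrite exprn_ge0 //; lra.
have Q0 : 0 < Q by rewrite Qdef mulr_gt0 // exprn_gt0 //; lra.
(* Each of the three error terms receives a third of [eps / 16]. *)
have b1 : q * M / N <= eps / 48.
  rewrite ler_pdivrMr // (le_trans (ler_pM q0 M0 qP MP)) //.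
  have -> : 23 * P * (792 * T * P) = 18216 * (T * P ^+ 2) by ring.
  have : T * P ^+ 2 <= T ^+ 3 by rewrite exprS ler_wpM2l //; lra.
  lra.
(* Here [1 <= eps * T] enters: [T <= eps * T ^+ 2 <= 4 * eps * P ^+ 2]. *)
have b2 : M / Q <= eps / 48.
  rewrite ler_pdivrMr // (le_trans MP) // Qdef.
  have -> : eps / 48 * (2 ^+ 23 * P ^+ 3) = eps * P ^+ 2 / 48 * 2 ^+ 23 * P by ring.
  rewrite ler_wpM2r //; first by lra.
  have T2 : T ^+ 2 <= 4 * P ^+ 2.
    by rewrite (_ : 4 * P ^+ 2 = (2 * P) ^+ 2) ?lerXn2r ?nnegrE //; [lra|lra|ring].
  have : T <= eps * T ^+ 2 by rewrite expr2 mulrA ler_peMl //; lra.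
  have : eps * T ^+ 2 <= eps * (4 * P ^+ 2) by rewrite ler_wpM2l // ltW.
  lra.
have b3 : Q / N <= eps / 48.
  by rewrite ler_pdivrMr // Qdef; lra.
lra.
Qed.

Theorem theorem2p1 (R : realType) :
  exists c0 : R, 0 < c0 < 1 /\
  exists C : R, 0 < C /\
  forall (d t : nat) (eps : R), 0 < eps < 1 ->
    t%:R <= c0 * powR eps (5 / 4) * powR 2 (d%:R / 4) ->
    exists A : nonadaptive_alg (cube d),
      @one_sided_linearity_tester R d t eps A /\
      forall w : coins A,
        (size (queries w))%:R <= C * eps^-1 * (1 + ln (1 + t%:R / eps)).
Proof.
(* [512 ^+ 4 = 2 ^+ 36], the constant of [erasure_budget]. *)
exists (1 / 512); split; first by lra.
(* [792 = 33 * 24], from [r <= 33 / eps] and [q + 1 <= 24 * (1 + ln (1 + t / eps))]. *)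
exists 792; split; first by lra.
move=> d t eps eps01 t_small; have /andP[e0 e1] := eps01.
have ie1 : 1 < eps^-1 by rewrite invf_gt1.
have [r /andP[r_ge r_le]] := @nat_ceil R (32 * eps^-1) ltac:(lra).
have r_eps : 32 <= r%:R * eps by rewrite -ler_pdivrMr.
have {}r_le : r%:R <= 33 * eps^-1 by lra.
have L0 : 0 <= ln (1 + t%:R / eps).
  by rewrite ln_ge0 // lerDl divr_ge0 // ltW.
(* Without erasures the smallest admissible [q = 2] suffices for every [d]. *)
case: (posnP t) => [t0|t_gt0].
  exists (tester d 2 r); split.
    by apply: tester_correct => //; rewrite t0 mul0n muln0 mul0r add0r; lra.
  move=> w; rewrite size_tester_queries natrM.
  have : 0 <= eps^-1 * ln (1 + t%:R / eps) by rewrite mulr_ge0 //; lra.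
  lra.
set T := t%:R / eps.
have T1 : eps^-1 <= T by rewrite /T ler_peMl ?ler1n //; lra.
have [l /andP[l_le l_ge]] := @pow2_approx R T ltac:(lra).
(* Used to bound the logarithmic factors in [q] and [M] by the power of two. *)
have lP : l%:R + 1 <= 2 ^+ l :> R by rewrite natr1 -natrX ler_nat ltn_expl.
have l0 : 0 <= l%:R :> R by [].
(* [2 ^+ q] is of order [T ^+ 3]: a square would leave the logarithmic factor of [M]
   uncompensated. *)
exists (tester d (3 * l + 23) r); split; last first.
  move=> w; rewrite size_tester_queries natrM -mulrA.
  have -> : 792 * (eps^-1 * (1 + ln (1 + T))) =
    33 * eps^-1 * (24 * (1 + ln (1 + T))) by ring.
  rewrite ler_pM // -natr1 natrD natrM.
  have := log2_le_ln l_le; move: L0; rewrite -/T; lra.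
apply: tester_correct => //; first by lia.
have -> : (t * (r * (3 * l + 23).+1))%N == 0%N = false.
  apply/negbTE; rewrite -lt0n !muln_gt0 t_gt0 /= andbT -(@ltr0n R).
  by apply: lt_le_trans r_ge; lra.
have N0 : 0 < #|cube d|%:R :> R by exact: card_cube_gt0.
rewrite natrM; apply: (@erasure_budget R _ eps T (2 ^+ l)) => //.
- by rewrite /T mulrCA divff ?gt_eqF // mulr1 ler1n.
- by lra.
- by lra.
- by rewrite natrD natrM; lra.
- rewrite !natrM -[(_.+1)%:R]natr1 natrD natrM.
  have -> : 792 * T * 2 ^+ l = t%:R * (33 * eps^-1 * (24 * 2 ^+ l)) by rewrite /T; ring.
  by rewrite ler_wpM2l // ler_pM //; lra.
- by rewrite addnC exprD mulnC exprM.
have t4 := @bound_pow4 R d t (1 / 512) eps ltac:(lra) (ltW e0) t_small.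
have -> : T ^+ 4 = t%:R ^+ 4 / eps ^+ 4 by rewrite /T expr_div_n.
rewrite mulrA ler_pdivrMr ?exprn_gt0 //.
have -> : eps * #|cube d|%:R * eps ^+ 4 =
  2 ^+ 36 * ((1 / 512) ^+ 4 * eps ^+ 5 * #|cube d|%:R) by field.
by rewrite ler_wpM2l ?exprn_ge0.
Qed.
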